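(* Let $(A,\cdot,\bullet)$ be a skew brace. Any two of the following conditions imply the third: 1) $A$ is two-sided; 2) the operation $\star$ is associative, i.e. $(a\star b)\star c=a\star(b\star c)$ for all $a,b,c\in A$; 3) $A\star A\subseteq Z(A^{\cdot})$.
   Context: A skew brace is a triple $(A,\cdot,\bullet)$ where $A^{\cdot}=(A,\cdot)$ and $A^{\bullet}=(A,\bullet)$ are groups with the same identity $1$ such that $a\bullet(b\cdot c)=(a\bullet b)\cdot a^{-1}\cdot(a\bullet c)$ for all $a,b,c\in A$, where $a^{-1}$ denotes the inverse of $a$ in $A^{\cdot}$. It is two-sided if in addition $(a\cdot b)\bullet c=(a\bullet c)\cdot c^{-1}\cdot(b\bullet c)$ for all $a,b,c\in A$. The $\star$-product is $a\star b:=a^{-1}\cdot(a\bullet b)\cdot b^{-1}$. $A\star A$ denotes the subgroup of $A^{\cdot}$ generated by all elements $a\star b$ with $a,b\in A$, and $Z(A^{\cdot})$ is the center of the group $A^{\cdot}$. *)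

(* Defs.v *)
From HB Require Import structures.
From mathcomp Require Import all_boot.
From mathcomp Require Import boolp classical_sets.

Set Implicit Arguments.
Unset Strict Implicit.
Unset Printing Implicit Defensive.

Local Open Scope classical_set_scope.
Local Open Scope group_scope.

Declare Scope skew_brace_scope.
Delimit Scope skew_brace_scope with SB.
Reserved Notation "x • y" (at level 40, left associativity).
Reserved Notation "x ⋆ y" (at level 40, left associativity).

(* [A] with its [groupType] operations [*], [^-1], [1] is the group (A, .);
   [circ] is the second group law. The two groups share the identity [1]. *)
HB.mixin Record Group_isSkewBrace A of Group A := {
  circ : A -> A -> A;
  cinv : A -> A;
  circA : associative circ;
  circ1g : left_id (1 : A) circ;
  circg1 : right_id (1 : A) circ;
  circVg : left_inverse (1 : A) cinv circ;
  circgV : right_inverse (1 : A) cinv circ;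
  circMr : forall a b c : A, circ a (b * c) = circ a b * a^-1 * circ a c
}.

#[short(type="skewBraceType")]
HB.structure Definition SkewBrace := {A of Group_isSkewBrace A & Group A}.

Notation "x • y" := (circ x y) : skew_brace_scope.
Local Open Scope skew_brace_scope.

(* The carrier of [A] as a [groupType] for the second law. *)
Definition circ_group (A : skewBraceType) : Type := A.

HB.instance Definition _ (A : skewBraceType) := Choice.on (circ_group A).
HB.instance Definition _ (A : skewBraceType) :=
  isGroup.Build (circ_group A)
    (@circA A) (@circ1g A) (@circg1 A) (@circVg A) (@circgV A).

Definition two_sided (A : skewBraceType) : Prop :=
  forall a b c : A, (a * b) • c = (a • c) * c^-1 * (b • c).

Definition star (A : skewBraceType) (a b : A) : A := a^-1 * (a • b) * b^-1.
Notation "x ⋆ y" := (star x y) : skew_brace_scope.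

Definition star_associative (A : skewBraceType) : Prop :=
  forall a b c : A, (a ⋆ b) ⋆ c = a ⋆ (b ⋆ c).

(* MathComp's [<<_>>] and ['Z(_)] require finite groups; these are the
   same notions in an arbitrary group, as classical sets. *)
Definition generated_subgroup (G : groupType) (X : set G) : set G :=
  smallest (fun H : set G => group_closed (mem H)) X.

Definition group_center (G : groupType) : set G :=
  [set z | forall x : G, commute z x].

(* The subgroup is generated in (A, .), not in [circ_group A]. *)
Definition star_square (A : skewBraceType) : set A :=
  generated_subgroup [set x | exists a b : A, x = a ⋆ b].
Arguments star_square : clear implicits.
Arguments group_center : clear implicits.

(* Main.v *)
From HB Require Import structures.
Require Import Defs.
From mathcomp Require Import all_boot all_algebra.
From mathcomp Require Import generic_quotient.
From mathcomp Require Import boolp classical_sets.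

(** Write [λ_a(b) = a^-1 * (a • b)], an automorphism of the group [A] which
    depends on [a] through a morphism from [circ_group A]. Then
    [a ⋆ b = λ_a(b) * b^-1] and [a • b = a * (a ⋆ b) * b], so that
    [star_circ] expands [(a • b) ⋆ c] in every skew brace, while
    two-sidedness is a rule for [(a * b) ⋆ c] ([two_sidedP]). Condition 3 says that all star products are central
    ([star_square_center]).

    1 and 3 imply 2: comparing both expansions of [(a • b) ⋆ c] gives
    associativity ([two_sided_central_assoc]).

    2 and 3 imply 1: it must be shown that [f = _ ⋆ c] is multiplicative. Using
    that [a * λ_a(w) = a • w], this reduces to central elements
    ([star_lam_reduce]), where [*] is commutative and [⋆] is an associative,
    left distributive product with [u • v = u + v + u ⋆ v]. There, rewriting
    sums as circle products shows that the defect of additivity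
    [D(a, b) = f(a + b) - f(a) - f(b)] is unchanged, up to sign and
    left multiplication, under several substitutions on [(a, b)]. A cycle of
    these gives [D(a, b) = e ⋆ D(a, b)] for some [e]. As [λ_{-e}] is injective
    and sends [D(a, b)] to [D(a, b) - D(a, b)], the defect vanishes
    ([circ_additive_additive]).

    1 and 2 imply 3: expanding [(a * b) ⋆ (c * d)] in two ways shows that
    [c^-1 * (b • c) * b^-1] centralises all star products. Modulo the
    centraliser of the star products, [b ⋆ c] is thus the commutator
    [b^-1 * c * b * c^-1]. A group whose commutator operation is associative is
    nilpotent of class at most two ([lcomm_commute3]), so [a ⋆ (b ⋆ c)]
    centralises all star products ([cent_star_triple]). Feeding this into the
    expansion of [a ⋆ (c ⋆ (g * d))] shows that star products commute with one
    another ([star_commute]), and then the expansions of [(a • b) ⋆ c] show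
    that [a ⋆ λ_b(c)] commutes with [b]; as [λ_b] is onto, every [a ⋆ d] is
    central ([two_sided_assoc_central]). *)

Set Implicit Arguments.
Unset Strict Implicit.
Unset Printing Implicit Defensive.

Local Open Scope classical_set_scope.
Local Open Scope group_scope.
Import GRing.Theory.

(** Reduced left-associated words are normal forms in a free group. The
    rewriting sees through definitions such as that of [⋆], so the word
    identities about star products are proved below for variables. *)
Ltac free_group := rewrite /conjg ?(invgM, invgK, mulgA, mulg1, mul1g, mulgV,
  mulVg, mulgK, mulgVK, invg1).

(** * Groups whose commutator operation is associative *)

Section AssociativeCommutator.
Variable G : groupType.
Implicit Types a b c d g h x y : G.

(** This is [[~ a, b^-1]]; the inverse on [b] is what makes the star product
    of a two-sided skew brace become [lcomm] modulo [cent_star]. *)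
Definition lcomm a b := a^-1 * b * a * b^-1.

Hypothesis lcommA : forall a b c, lcomm (lcomm a b) c = lcomm a (lcomm b c).

Lemma lcomm1P a b : lcomm a b = 1 <-> commute a b.
Proof.
rewrite /commute /lcomm; split=> [|ab].
  by move/(congr1 (fun x => a * x * b)); free_group.
by rewrite -(mulgA a^-1) -ab; free_group.
Qed.

Lemma lcommEl a b : lcomm a b = a^-1 * a ^ b^-1.
Proof. by rewrite /lcomm; free_group. Qed.

Lemma lcommEr a b : lcomm a b = b ^ a * b^-1.
Proof. by rewrite /lcomm; free_group. Qed.

(** The law [lcommA] with a repeated entry: [lcomm x x = 1] makes a commutator
    commute with both of its entries, so [G] is a 2-Engel group. *)
Lemma lcomm_commute a b : commute a (lcomm a b) /\ commute b (lcomm a b).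
Proof.
have gg x : lcomm x x = 1 by apply/lcomm1P.
split.
  apply/lcomm1P; rewrite -lcommA gg.
  exact/lcomm1P/commute_sym/commute1.
by apply/commute_sym/lcomm1P; rewrite lcommA gg; apply/lcomm1P/commute1.
Qed.

(** Membership in the centraliser of the normal closure of [a]. *)
Definition cent_conj a x := forall g, commute x (a ^ g).

Lemma cent_conjJ a x g : cent_conj a x -> cent_conj a (x ^ g).
Proof.
move=> ax h; have := ax (h * g^-1).
rewrite /commute => /(congr1 (conjg^~ g)).
by rewrite (conjMg x) (conjMg _ x) -conjgM mulgVK.
Qed.

Lemma cent_conjM a x y : cent_conj a x -> cent_conj a y -> cent_conj a (x * y).
Proof. by move=> ax ay g; apply/commute_sym/commuteM; apply: commute_sym. Qed.

Lemma cent_conjV a x : cent_conj a x -> cent_conj a x^-1.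
Proof. by move=> ax g; apply/commute_sym/commuteV/commute_sym. Qed.

Lemma cent_conj_lcomml a x d : cent_conj a x -> cent_conj a (lcomm x d).
Proof.
move=> ax; rewrite lcommEl.
by apply: cent_conjM; [apply: cent_conjV|apply: cent_conjJ].
Qed.

(** The normal closure of one element is abelian: a conjugate of [a] is [a]
    times a commutator having [a] as an entry. *)
Lemma cent_conj_refl a : cent_conj a a.
Proof.
move=> g; have [ca _] := lcomm_commute a g^-1.
have -> : a ^ g = a * lcomm a g^-1 by rewrite lcommEl; free_group.
exact: commuteM.
Qed.

Lemma lcomm_cent a b : cent_conj a (lcomm a b) /\ cent_conj b (lcomm a b).
Proof.
split; first exact/cent_conj_lcomml/cent_conj_refl.
rewrite lcommEr; apply: cent_conjM; first exact/cent_conjJ/cent_conj_refl.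
exact/cent_conjV/cent_conj_refl.
Qed.

Lemma commute_lcomm a x c : cent_conj a x -> commute x (lcomm a c).
Proof.
move=> ax; rewrite lcommEl; apply: commuteM => //; apply: commuteV.
by rewrite -[a]conjg1.
Qed.

Lemma lcommMr x c d : lcomm x (c * d) = lcomm x c * (c * lcomm x d * c^-1).
Proof. by rewrite /lcomm; free_group. Qed.

Lemma lcommJ x y g : lcomm (x ^ g) (y ^ g) = lcomm x y ^ g.
Proof. by rewrite /lcomm; free_group. Qed.

Lemma conj_move p r s g :
  p * (r ^ g^-1 * p^-1) = g * s * g^-1 -> p ^ g * r = s * p ^ g.
Proof. by move=> /(congr1 (fun x => g^-1 * x * p * g)); free_group. Qed.

(** The derived subgroup is abelian. Put [y := lcomm b d]. Expanding [lcommA]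
    for [c], [b], [a * d] gives [lcomm (c ^ a) y = lcomm c y], up to a
    conjugation by a product of conjugates of [b] and [b^-1]; this one is
    harmless as [lcomm c y = lcomm (lcomm c b) d] centralises the conjugates
    of [b]. Hence [y] commutes with [c ^ a * c^-1 = lcomm a c]. *)
Lemma commute_lcomm2 a b c d : commute (lcomm a c) (lcomm b d).
Proof.
set y := lcomm b d; set q := lcomm b a; set t := lcomm c y.
have qt : commute t (q ^ a).
  have bt : cent_conj b t.
    by rewrite /t /y -lcommA; apply: cent_conj_lcomml; case: (lcomm_cent c b).
  rewrite /q lcommEl conjMg conjVg; apply: commuteM; first exact: commuteV.
  by rewrite -conjgM.
have : q ^ a * lcomm (c ^ a) y = t * q ^ a.
  have := lcommA c b (a * d).
  rewrite (lcommMr _ a d) (lcommMr b a d) (lcommMr c q (a * y * a^-1)) -/q.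
  rewrite (lcommA c b a) -/q => /mulgI; rewrite (lcommA c b d) -/y -/t.
  have -> : lcomm c (a * y * a^-1) = lcomm (c ^ a) y ^ a^-1.
    by rewrite -lcommJ -conjgM mulgV conjg1; free_group.
  by move=> H; apply: conj_move; rewrite mulgA -H.
rewrite qt => /mulgI /(congr1 (fun x => c ^ a * x * y * c^-1)).
by rewrite /t /lcomm /commute; free_group.
Qed.

(** Compute [lcomm a b ^ c^-1] in two ways: as [u * lcomm u c] for
    [u := lcomm a b], and as the commutator of the conjugates [a * X] and
    [b * Y], where [X := lcomm a c] and [Y := lcomm b c]. By [lcommA], the
    factor [lcomm u c = lcomm a Y] appears on both sides; what is left says
    that [X] and [b] commute. All commutators are thus central. *)
Lemma lcomm_commute3 a b c : commute (lcomm a c) b.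
Proof.
set u := lcomm a b; set X := lcomm a c; set Y := lcomm b c; set t := lcomm a Y.
have ct : lcomm u c = t by exact: lcommA.
have tX : commute t X.
  apply: commute_lcomm; rewrite -ct; apply: cent_conj_lcomml.
  by case: (lcomm_cent a b).
have tb : commute t b.
  rewrite -ct -[b]conjg1; apply: cent_conj_lcomml.
  by case: (lcomm_cent a b).
have YX : commute Y X by exact: commute_lcomm2.
have uX : commute u X by exact: commute_lcomm2.
have : u * t = lcomm (a * X) (b * Y).
  have -> : a * X = a ^ c^-1 by rewrite /X lcommEl mulVKg.
  have -> : b * Y = b ^ c^-1 by rewrite /Y lcommEl mulVKg.
  by rewrite lcommJ -ct lcommEl mulVKg.
have -> : lcomm (a * X) (b * Y) = X^-1 * u * b * X * b^-1 * t.
  have -> : lcomm (a * X) (b * Y) = X^-1 * u * b * t * (Y * X * Y^-1) * b^-1.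
    by rewrite /t /u /lcomm; free_group.
  rewrite YX mulgK -(mulgA _ t) tX.
  have tbV : commute t b^-1 by exact: commuteV.
  by rewrite -[RHS]mulgA -tbV !mulgA.
have cancel_u v z : commute v z -> v = z^-1 * v * b * z * b^-1 -> commute z b.
  move=> /commuteV vz; rewrite -vz -!mulgA -[v in LHS]mulg1 => /mulgI.
  by move=> /(congr1 (fun x => z * x * b)); free_group.
by move=> /mulIg; exact: cancel_u.
Qed.

End AssociativeCommutator.

(** * Quotient by a normal subgroup *)

Section Quotient.
Variables (G : groupType) (N : set G).
Hypotheses (N1 : N 1) (NM : forall x y, N x -> N y -> N (x * y))
  (NV : forall x, N x -> N x^-1) (NJ : forall x g, N x -> N (x ^ g)).

Definition same_coset x y := `[< N (x^-1 * y) >].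

Lemma same_coset_equiv : equiv_class_of same_coset.
Proof.
split=> [x|x y|y x z].
- by apply/asboolP; rewrite mulVg.
- by apply/asboolP/asboolP => /NV; rewrite invgM invgK.
- move=> /asboolP xy /asboolP yz; apply/asboolP.
  by have := NM xy yz; rewrite mulgA mulgK.
Qed.

Local Open Scope quotient_scope.

Canonical same_coset_equiv_rel := EquivRelPack same_coset_equiv.

Definition coset_quotient : Type := {eq_quot same_coset_equiv_rel}.
HB.instance Definition _ := Choice.on coset_quotient.
HB.instance Definition _ := EqQuotient.on coset_quotient.

Lemma pi_eqP x y : \pi_coset_quotient x = \pi_coset_quotient y <-> N (x^-1 * y).
Proof.
by split=> [/eqmodP|] H; [exact/asboolP|apply/eqmodP/asboolP].
Qed.

Definition quotient_mul (u v : coset_quotient) : coset_quotient :=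
  \pi_coset_quotient (repr u * repr v).
Definition quotient_inv (u : coset_quotient) : coset_quotient :=
  \pi_coset_quotient (repr u)^-1.

Lemma repr_pi x : N ((repr (\pi_coset_quotient x))^-1 * x).
Proof. by apply/pi_eqP; rewrite reprK. Qed.

Lemma pi_mul x y :
  \pi_coset_quotient (x * y) =
  quotient_mul (\pi_coset_quotient x) (\pi_coset_quotient y).
Proof.
apply/esym/pi_eqP; set r := repr _; set s := repr _.
have -> : (r * s)^-1 * (x * y) = (s^-1 * y) * (r^-1 * x) ^ y by free_group.
by apply: NM; [|apply: NJ]; exact: repr_pi.
Qed.

Lemma pi_inv x : \pi_coset_quotient x^-1 = quotient_inv (\pi_coset_quotient x).
Proof.
apply/esym/pi_eqP; set r := repr _.
have -> : r^-1^-1 * x^-1 = ((r^-1 * x)^-1) ^ r^-1 by free_group.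
by apply/NJ/NV/repr_pi.
Qed.

Lemma quotient_mulA : associative quotient_mul.
Proof.
move=> u v w; rewrite -[u]reprK -[v]reprK -[w]reprK.
rewrite -(pi_mul (repr v) (repr w)) -(pi_mul (repr u) (repr v)).
by rewrite -(pi_mul (repr u)) -(pi_mul _ (repr w)) mulgA.
Qed.
Lemma quotient_1mul : left_id (\pi_coset_quotient 1) quotient_mul.
Proof. by move=> u; rewrite -[u]reprK -(pi_mul 1) mul1g. Qed.
Lemma quotient_mul1 : right_id (\pi_coset_quotient 1) quotient_mul.
Proof. by move=> u; rewrite -[u]reprK -(pi_mul _ 1) mulg1. Qed.
Lemma quotient_Vmul :
  left_inverse (\pi_coset_quotient 1) quotient_inv quotient_mul.
Proof. by move=> u; rewrite -[u]reprK -pi_inv -(pi_mul (repr u)^-1) mulVg. Qed.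
Lemma quotient_mulV :
  right_inverse (\pi_coset_quotient 1) quotient_inv quotient_mul.
Proof. by move=> u; rewrite -[u]reprK -pi_inv -(pi_mul (repr u)) mulgV. Qed.

HB.instance Definition _ := isGroup.Build coset_quotient quotient_mulA
  quotient_1mul quotient_mul1 quotient_Vmul quotient_mulV.

Lemma quotient_by_normal : exists (Q : groupType) (p : G -> Q),
  [/\ {morph p : x y / x * y}, (forall u, exists x, u = p x) &
      forall x, p x = 1 <-> N x].
Proof.
exists coset_quotient, \pi_coset_quotient.
split=> [x y|u|x]; first exact: pi_mul.
  by exists (repr u); rewrite reprK.
have E := pi_eqP 1 x; rewrite invg1 mul1g in E.
by split=> [/esym/E|/E/esym].
Qed.

End Quotient.

(** * The centre of a group as an additive group *)

Section Center.
Variable G : groupType.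

Lemma center1 : group_center G 1.
Proof. by move=> x; apply/commute_sym/commute1. Qed.

Lemma centerM x y :
  group_center G x -> group_center G y -> group_center G (x * y).
Proof. by move=> xZ yZ z; apply/commute_sym/commuteM; apply: commute_sym. Qed.

Lemma centerV x : group_center G x -> group_center G x^-1.
Proof. by move=> xZ z; apply/commute_sym/commuteV/commute_sym. Qed.

Definition center := {x : G | `[< group_center G x >]}.
HB.instance Definition _ := Choice.on center.

Implicit Types u v w : center.

Lemma center_val u : group_center G (val u).
Proof. exact/asboolP/(svalP u). Qed.

Definition to_center x (xZ : group_center G x) : center :=
  exist _ x (asboolT xZ).

Definition center_add u v := to_center (centerM (center_val u) (center_val v)).
Definition center_opp u := to_center (centerV (center_val u)).

Lemma center_addA : associative center_add.
Proof. by move=> u v w; apply: val_inj; exact: mulgA. Qed.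
Lemma center_addC : commutative center_add.
Proof. by move=> u v; apply: val_inj; exact: center_val. Qed.
Lemma center_add0 : left_id (to_center center1) center_add.
Proof. by move=> u; apply: val_inj; exact: mul1g. Qed.
Lemma center_addN : left_inverse (to_center center1) center_opp center_add.
Proof. by move=> u; apply: val_inj; exact: mulVg. Qed.

HB.instance Definition _ :=
  GRing.isZmodule.Build center center_addA center_addC center_add0 center_addN.

Lemma center_valD u v : val (u + v)%R = val u * val v.
Proof. by []. Qed.

End Center.

(** * Additivity of maps compatible with a circle operation *)

Section CircAdditive.
Local Open Scope ring_scope.
Variables (V : zmodType) (m : V -> V -> V) (inv : V -> V).
Implicit Types a b c x y : V.

Local Notation "x ⊗ y" := (m x y) (at level 40, left associativity).
Local Notation "x ∘ y" := (x + y + x ⊗ y) (at level 50, left associativity).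

Hypothesis mDr : forall a b c, a ⊗ (b + c) = a ⊗ b + a ⊗ c.
Hypothesis m0 : forall b, 0 ⊗ b = 0.
Hypothesis mA : forall a b c, a ⊗ b ⊗ c = a ⊗ (b ⊗ c).
Hypothesis invV : forall a, inv a ∘ a = 0.
Hypothesis invK : forall a, a ∘ inv a = 0.

Definition circ_additive (g : V -> V) :=
  forall a b, g (a ∘ b) = g a + g b + g (a ⊗ b).

(** With [m_circl], the law [∘] is associative. *)
Hypothesis m_circl : forall c, circ_additive (m^~ c).

Lemma mr0 a : a ⊗ 0 = 0.
Proof. by apply: (addrI (a ⊗ 0)); rewrite -mDr !addr0. Qed.

Lemma mrN a b : a ⊗ (- b) = - (a ⊗ b).
Proof. by apply: (addrI (a ⊗ b)); rewrite -mDr !subrr mr0. Qed.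

Lemma mrB a b c : a ⊗ (b - c) = a ⊗ b - a ⊗ c.
Proof. by rewrite mDr mrN. Qed.

Lemma circ_addA a b c : (a ∘ b) ∘ c = a ∘ (b ∘ c).
Proof.
rewrite m_circl !mDr mA !addrA.
by rewrite (ACl (1*2*4*6*3*5*7))%AC /=; congr (_ + _); rewrite -!addrA.
Qed.

Lemma circ_addKl a b : inv a ∘ (a ∘ b) = b.
Proof. by rewrite -circ_addA invV m0 add0r addr0. Qed.

Lemma circ_addKr a b : a ∘ (inv a ∘ b) = b.
Proof. by rewrite -circ_addA invK m0 add0r addr0. Qed.

Lemma inv_inv a : inv (inv a) = a.
Proof. by rewrite -[RHS](circ_addKl (inv a)) invV mr0 !addr0. Qed.

Lemma mVKl a b : inv a ⊗ b + a ⊗ b + inv a ⊗ (a ⊗ b) = 0.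
Proof. by rewrite -mA -m_circl invV m0. Qed.

Lemma mVC a b : a ⊗ (inv a ⊗ b) = inv a ⊗ (a ⊗ b).
Proof.
apply: (addrI (inv a ⊗ b + a ⊗ b)); rewrite [RHS]mVKl (addrC (inv a ⊗ b)).
by rewrite -{1 3}(inv_inv a) mVKl.
Qed.

(** The element [a ∘ (- a)] equals [a ⊗ (- a)], so the two product terms of
    [circ_additive] cancel. *)
Lemma circ_additiveN (g : V -> V) :
  g 0 = 0 -> circ_additive g -> forall a, g (- a) = - g a.
Proof.
move=> g0 gC a; have := gC a (- a); rewrite subrr add0r -[LHS]add0r => /addIr.
by move/eqP; rewrite eq_sym addrC addr_eq0 => /eqP.
Qed.

Lemma mNl a b : (- a) ⊗ b = - (a ⊗ b).
Proof. by apply: (circ_additiveN (m0 b) (@m_circl b)). Qed.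

(** The map sending [d] to [d + (- x) ⊗ d] is injective, as [- x] is
    invertible for [∘], and it kills the fixed points of [x ⊗ _]. *)
Lemma m_fixed0 x d : x ⊗ d = d -> d = 0.
Proof.
move=> xd; have := mVKl (- x) d.
rewrite mNl xd mrN -addrA addrCA subrr addr0 => /eqP.
by rewrite oppr_eq0 => /eqP.
Qed.

Variable f : V -> V.
Hypothesis fD : circ_additive f.
Hypothesis fM : forall a b, f (a ⊗ b) = a ⊗ f b.

Lemma f0 : f 0 = 0.
Proof. by rewrite -(m0 0) fM m0. Qed.

Lemma fN a : f (- a) = - f a.
Proof. exact: (circ_additiveN f0 fD). Qed.

Definition defect a b := f (a + b) - f a - f b.

Lemma defectC a b : defect a b = defect b a.
Proof. by rewrite /defect (addrC a b) addrAC. Qed.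

Lemma defectNN a b : defect (- a) (- b) = - defect a b.
Proof. by rewrite /defect -(opprD a) !fN 2!opprD. Qed.

Lemma mdefect x a b : x ⊗ defect a b = defect (x ⊗ a) (x ⊗ b).
Proof. by rewrite /defect -mDr !fM !mrB. Qed.

(** Write [a + b] as [a ∘ (b + inv a ⊗ b)] and expand [f] there. *)
Lemma defect_rot a b : defect a b = defect b (inv a ⊗ b).
Proof.
have mV : a ⊗ (b + inv a ⊗ b) = - (inv a ⊗ b).
  apply/eqP; rewrite -addr_eq0 mDr mVC.
  by rewrite [X in X == _]addrC addrA mVKl.
have := fD a (b + inv a ⊗ b); rewrite mV fN -!addrA subrr addr0 => E.
by rewrite /defect E (addrC (f a)) addrK addrAC.
Qed.

(** Both arguments of [defect b (inv x ⊗ b)] change sign with [b]. *)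
Lemma defectNr x b : defect x (- b) = - defect x b.
Proof.
by rewrite defect_rot mrN defectNN -defect_rot.
Qed.

(** Both sides are [f (a + b ⊗ a) - f a - f (b ⊗ a)]: on the right
    [(b ∘ a) - b] is that first argument. *)
Lemma defectVl a b : defect (inv b) a = - defect (b ∘ a) b.
Proof.
rewrite -defectNr defect_rot inv_inv /defect.
have -> : b ∘ a - b = a + b ⊗ a by rewrite -addrA addrC addrA subrK addrC.
rewrite fD fN opprK -!addrA; congr (_ + _).
by rewrite -opprD (addrC (f b)) (opprD _ (f b)) subrK.
Qed.

(** As [a ∘ b - b] is [a + a ⊗ b], both sides are [- defect a (a ⊗ b)]. *)
Lemma defect_circr a b : defect (a ∘ b) b = - (a ⊗ defect a b).
Proof.
have -> : a ⊗ defect a b = defect a (a ⊗ b).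
  by rewrite (defect_rot a (a ⊗ b)) -mVC -mdefect -defect_rot.
rewrite -[LHS]opprK -defectNr; congr (- _); rewrite /defect.
have -> : a ∘ b - b = a + a ⊗ b by rewrite addrAC addrK.
rewrite fD fN opprK -!addrA; congr (_ + _).
by rewrite -opprD addrCA (addrC (f b)) (opprD _ (f b)) subrK.
Qed.

(** Using [defectVl] and [defect_circr] alternately moves the pair [(a, b)]
    through [(inv b ∘ a, inv b)], [(q, inv b)], [(a ∘ b, b)] and back to
    [(a, b)], where [q := inv b ∘ a ∘ b]. The signs cancel over this cycle and
    the defect is a fixed point of [(q ⊗ a) ⊗ _]. *)
Lemma circ_additive_additive a b : f (a + b) = f a + f b.
Proof.
suff D0 : defect a b = 0.
  by move/eqP: D0; rewrite /defect -addrA -opprD subr_eq0 => /eqP.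
set q := inv b ∘ a ∘ b.
apply: (@m_fixed0 (q ⊗ a)); rewrite mA.
have E1 : defect (inv b) (inv b ∘ a) = - defect a b.
  by rewrite defectVl circ_addKr.
have E2 : defect (inv b) q = - defect (a ∘ b) b.
  by rewrite defectVl /q circ_addA circ_addKr.
have E3 : inv b ∘ a = q ∘ inv b.
  by rewrite /q circ_addA invK mr0 !addr0.
rewrite -[RHS]opprK -E1 (defectC (inv b)) E3 defect_circr (defectC q) E2.
by rewrite defect_circr !opprK.
Qed.

End CircAdditive.

(** * Skew braces *)

Section SkewBrace.
Variable A : skewBraceType.
Implicit Types a b c d x y z : A.
Local Open Scope skew_brace_scope.

(** The action of [circ_group A] by automorphisms of the group [A]. *)
Definition lam a b := a^-1 * (a • b).

Lemma circE a b : a • b = a * (a ⋆ b) * b.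
Proof. by rewrite /star; free_group. Qed.

Lemma lamE a b : lam a b = a ⋆ b * b.
Proof. by rewrite /star /lam; free_group. Qed.

Lemma lamM a b c : lam a (b * c) = lam a b * lam a c.
Proof. by rewrite /lam circMr; free_group. Qed.

Lemma lam1 a : lam a 1 = 1.
Proof. by rewrite /lam circg1 mulVg. Qed.

Lemma lamV a b : lam a b^-1 = (lam a b)^-1.
Proof. by apply/esym/mulg1_eq; rewrite -lamM mulgV lam1. Qed.

Lemma lam_circ a b c : lam (a • b) c = lam a (lam b c).
Proof. by rewrite {3}/lam lamM lamV /lam circA; free_group. Qed.

Lemma star1r a : a ⋆ 1 = 1.
Proof. by rewrite /star circg1 invg1 mulg1 mulVg. Qed.
Lemma star1l a : 1 ⋆ a = 1.
Proof. by rewrite /star circ1g invg1 mul1g mulgV. Qed.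

Lemma starMr a b c : a ⋆ (b * c) = (a ⋆ b) * b * (a ⋆ c) * b^-1.
Proof. by rewrite /star circMr; free_group. Qed.

Lemma star_circ a b c : (a • b) ⋆ c = a ⋆ (b ⋆ c) * (b ⋆ c) * (a ⋆ c).
Proof.
have -> : (a • b) ⋆ c = lam a (lam b c) * c^-1.
  by rewrite -lam_circ lamE mulgK.
by rewrite (lamE b) lamM !lamE (mulgA _ (a ⋆ c) c) (mulgK c).
Qed.

(** The star-product form of two-sidedness: it says how far [_ ⋆ c] is from
    being a morphism of the group [A]. *)
Lemma two_sidedP : two_sided A <->
  forall a b c, (a * b) ⋆ c = b^-1 * (a ⋆ c) * b * (b ⋆ c).
Proof.
split=> AT a b c.
  by rewrite /star AT; free_group.
by rewrite !circE AT; free_group.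
Qed.

Lemma lam_surj a d : exists c, d = lam a c.
Proof.
exists (cinv a • (a * d)).
by rewrite /lam circA circgV circ1g mulKg.
Qed.

Definition central_star := forall a b, group_center A (a ⋆ b).

Lemma star_square_center :
  star_square A `<=` group_center A <-> central_star.
Proof.
split=> [AZ a b|AZ].
  apply: (AZ (a ⋆ b)).
  by apply: (@sub_smallest _ _ _ [set x | exists a b, x = a ⋆ b]) => //;
     exists a, b.
apply: smallest_sub => [|_ [a [b ->]]]; last exact: AZ.
split=> [|x y]; rewrite !inE; first exact: center1.
by move=> xZ yZ; apply: centerM => //; apply: centerV.
Qed.

(** When star products are central, [two_sidedP] makes [_ ⋆ c]
    multiplicative; then both sides of [star_circ], with [a • b] written as
    [a * (a ⋆ b) * b] on the left, differ only in the association of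
    [a ⋆ b ⋆ c]. *)
Lemma two_sided_central_assoc :
  two_sided A -> central_star -> star_associative A.
Proof.
move=> /two_sidedP starMl AZ a b c.
have starMlZ x y : (x * y) ⋆ c = (x ⋆ c) * (y ⋆ c).
  by rewrite starMl -(mulgA y^-1) AZ mulKg.
have := star_circ a b c; rewrite circE (starMlZ (a * (a ⋆ b))) (starMlZ a).
by rewrite -[RHS](AZ a c) (mulgA (a ⋆ c) _ (b ⋆ c)) => /mulIg /mulgI.
Qed.

Section AssociativeCentral.
Hypotheses (AA : star_associative A) (AZ : central_star).

Lemma cinv_center z : group_center A z -> group_center A (cinv z).
Proof.
move=> zZ; have /mulg1_eq <- : z * (z ⋆ cinv z) * cinv z = 1.
  by rewrite -circE circgV.
exact/centerV/centerM.
Qed.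

(** The centre of the group [A], written additively, with [⋆], satisfies the
    hypotheses of [circ_additive_additive]. *)
Lemma star_center_additive z w c : group_center A z -> group_center A w ->
  (z * w) ⋆ c = (z ⋆ c) * (w ⋆ c).
Proof.
move=> zZ wZ.
pose m (u v : center A) := to_center (AZ (val u) (val v)).
pose inv (u : center A) := to_center (cinv_center (center_val u)).
have m_circ u v : val (u + v + m u v)%R = val u • val v.
  rewrite !center_valD circE -2!(mulgA (val u)); congr (_ * _).
  exact: (center_val v).
have fD (d : A) : circ_additive m (fun u => to_center (AZ (val u) d)).
  move=> u v; apply: val_inj.
  change (val (u + v + m u v)%R ⋆ d =
    (val u ⋆ d) * (val v ⋆ d) * ((val u ⋆ val v) ⋆ d)).
  rewrite m_circ star_circ -AA -[LHS](AZ (val u) d) -[RHS]mulgA.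
  by congr (_ * _); apply: AZ.
pose f (u : center A) := to_center (AZ (val u) c).
suff /(congr1 val) : f (to_center zZ + to_center wZ)%R =
  (f (to_center zZ) + f (to_center wZ))%R by [].
apply: (@circ_additive_additive _ m inv).
- move=> u v v'; apply: val_inj.
  change (val u ⋆ (val v * val v') = (val u ⋆ val v) * (val u ⋆ val v')).
  rewrite starMr -(mulgA (val u ⋆ val v)) -(AZ (val u)).
  by rewrite (mulgA (val u ⋆ val v)) mulgK.
- by move=> v; apply: val_inj; exact: star1l.
- by move=> u v v'; apply: val_inj; exact: AA.
- by move=> u; apply: val_inj; rewrite m_circ; exact: circVg.
- by move=> u; apply: val_inj; rewrite m_circ; exact: circgV.
- by move=> v; exact: fD.
- exact: fD.
- by move=> u v; apply: val_inj; exact: AA.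
Qed.

(** Multiplicativity of [_ ⋆ c] on a pair [(a, lam a w)] reduces to the pair
    [(a ⋆ w, w)], because [a * lam a w] is [a • w] and [star_circ] applies. *)
Lemma star_lam_reduce a w c : (a ⋆ w * w) ⋆ c = (a ⋆ w) ⋆ c * (w ⋆ c) ->
  (a * lam a w) ⋆ c = (a ⋆ c) * (lam a w ⋆ c).
Proof.
move=> E; have -> : a * lam a w = a • w by rewrite /lam mulVKg.
by rewrite star_circ lamE E -AA -[LHS](AZ a c).
Qed.

(** Two reductions by [star_lam_reduce]: a pair of arbitrary elements goes to a
    pair with one central entry, and such a pair to two central elements. *)
Lemma assoc_central_two_sided : two_sided A.
Proof.
have starMlr a z c : group_center A z -> (a * z) ⋆ c = (a ⋆ c) * (z ⋆ c).
  move=> zZ; have [w zE] := lam_surj a z; rewrite {}zE in zZ *.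
  apply/star_lam_reduce/star_center_additive => //.
  have -> : w = (a ⋆ w)^-1 * lam a w by rewrite lamE mulKg.
  by apply: centerM => //; apply: centerV.
apply/two_sidedP => a b c; rewrite -(mulgA b^-1) AZ mulKg.
have [w ->] := lam_surj a b; apply: star_lam_reduce.
by rewrite AZ starMlr // AZ.
Qed.

End AssociativeCentral.

Definition cent_star : set A := [set x | forall a b, commute x (a ⋆ b)].

Lemma cent_star1 : cent_star 1.
Proof. by move=> a b; exact/commute_sym/commute1. Qed.

Lemma cent_starM x y : cent_star x -> cent_star y -> cent_star (x * y).
Proof.
by move=> xN yN a b; apply/commute_sym/commuteM; apply: commute_sym.
Qed.

Lemma cent_starV x : cent_star x -> cent_star x^-1.
Proof. by move=> xN a b; apply/commute_sym/commuteV/commute_sym. Qed.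

(** By [starMr], the subgroup generated by star products is normal. *)
Lemma cent_starJ x g : cent_star x -> cent_star (x ^ g).
Proof.
move=> xN a b.
have xJ : commute x (g * (a ⋆ b) * g^-1).
  have -> : g * (a ⋆ b) * g^-1 = (a ⋆ g)^-1 * (a ⋆ (g * b)).
    by rewrite starMr -2!(mulgA (a ⋆ g)) mulKg.
  by apply: commuteM => //; apply: commuteV.
have := congr1 (conjg^~ g) xJ; rewrite (conjMg x) (conjMg _ x).
have gJK y : (g * y * g^-1) ^ g = y by free_group.
by rewrite gJK.
Qed.

Section TwoSidedAssociative.
Hypotheses (AT : two_sided A) (AA : star_associative A).

Let starMl a b c : (a * b) ⋆ c = b^-1 * (a ⋆ c) * b * (b ⋆ c).
Proof. by move: a b c; apply/two_sidedP. Qed.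

(** Compare the two expansions of [(a * b) ⋆ (c * d)]: on the first factor and
    then on the second, or in the other order. *)
Lemma cent_star_circ b c : cent_star (c^-1 * (b • c) * b^-1).
Proof.
move=> a d; rewrite circE.
have swap x y z w : b^-1 * (y * c * x * c^-1) * b * (z * c * w * c^-1) =
    b^-1 * y * b * z * c * (b^-1 * x * b * w) * c^-1 ->
    commute (c^-1 * (b * z * c) * b^-1) x.
  move=> /(congr1 (fun e => c^-1 * y^-1 * b * e * c * w^-1 * b^-1)).
  by rewrite /commute; free_group.
apply: (swap _ (a ⋆ c) _ (b ⋆ d)).
by rewrite -!starMr -!starMl starMr.
Qed.

(** Modulo the centraliser of all star products, [cent_star_circ] turns [⋆]
    into [lcomm]; as [⋆] is associative, the quotient is nilpotent of class at
    most two. *)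
Lemma cent_star_triple a b c : cent_star (a ⋆ (b ⋆ c)).
Proof.
have [Q [p [pM p_surj pN]]] :=
  quotient_by_normal cent_star1 cent_starM cent_starV cent_starJ.
have pV x : p x^-1 = (p x)^-1.
  by apply/esym/mulg1_eq; rewrite -pM mulgV; apply/pN/cent_star1.
have p_star x y : p (x ⋆ y) = lcomm (p x) (p y).
  have /pN := cent_star_circ x y.
  rewrite circE (pM _ x^-1) (pM y^-1) (pM _ y) (pM x) !pV /lcomm.
  move=> /(congr1 (fun e : Q => (p x)^-1 * p y * e * p x * (p y)^-1)).
  by free_group.
have QA (u v w : Q) : lcomm (lcomm u v) w = lcomm u (lcomm v w).
  have [x ->] := p_surj u; have [y ->] := p_surj v; have [z ->] := p_surj w.
  by rewrite -!p_star AA.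
apply/pN; rewrite !p_star; apply/lcomm1P.
exact/commute_sym/lcomm_commute3.
Qed.

(** Expand both sides of [(a ⋆ c) ⋆ (g * d) = a ⋆ (c ⋆ (g * d))] by [starMr],
    with [g := b^-1]. By [cent_star_triple] all factors cancel, except for a
    commutator of [a ⋆ b] and [c ⋆ d]. *)
Lemma star_commute a b : cent_star (a ⋆ b).
Proof.
move=> c d; pose g := b^-1.
(* Here q, t, y, u stand for [c ⋆ g], [a ⋆ (c ⋆ d)], [c ⋆ d], [a ⋆ b]. *)
have cancel_t q t y u : g * t * g^-1 =
    q * (a ⋆ g) * q^-1 * (q * g * t * (q * g)^-1) *
    (q * g * y * u * (q * g * y)^-1) ->
    a ⋆ g = g * u^-1 * g^-1 -> commute (g * t * g^-1) q ->
    commute t u -> commute u y.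
  move=> E1 E2 tq tu.
  have : g * t * g^-1 = q * (g * u^-1 * t * y * u * y^-1 * g^-1) * q^-1.
    by rewrite E1 E2; free_group.
  move=> /(congr1 (fun x => x * q)); rewrite tq.
  move=> /(congr1 (fun x => t^-1 * u * g^-1 * q^-1 * x * g * y)).
  have tuK : t^-1 * u * t = u by rewrite -mulgA -tu mulKg.
  by free_group; rewrite tuK.
apply: (cancel_t (c ⋆ g) (a ⋆ (c ⋆ d))).
- have := AA a c (g * d).
  rewrite (starMr (a ⋆ c)) (starMr c) (AA a c g) (AA a c d).
  rewrite (starMr a (_ * (c ⋆ d))) (starMr a (_ * g)) (starMr a (c ⋆ g)).
  rewrite (invgK b : g^-1 = b).
  have cancel_k k q r t u y : k * g * t * b =
    k * q * r * q^-1 * (q * g) * t * (q * g)^-1 * (q * g * y) * u *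
    (q * g * y)^-1 -> g * t * b =
    q * r * q^-1 * (q * g * t * (q * g)^-1) * (q * g * y * u * (q * g * y)^-1).
    by move=> /(congr1 (fun x => k^-1 * x)); free_group.
  exact: cancel_k.
- have := starMr a g b; rewrite /g mulVg star1r -/g.
  have solve_r r u : 1 = r * g * u * g^-1 -> r = g * u^-1 * g^-1.
    by move=> /(congr1 (fun x => x * g * u^-1 * g^-1)); free_group.
  exact: solve_r.
- have := cent_starJ b (cent_star_triple a c d).
  by rewrite /conjg mulgA -{2}[b]invgK; exact.
- exact: cent_star_triple.
Qed.

(** As star products commute, the two expansions of [(a • b) ⋆ c], by
    [star_circ] and by two-sidedness, say that [a ⋆ lam b c] commutes with [b].
    Since [lam b] is onto, [c] can be chosen so that [lam b c] is any given
    element. *)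
Lemma two_sided_assoc_central : central_star.
Proof.
move=> a d b; have [c ->] := lam_surj b d.
have comm_tr t q r : t * q * r = b^-1 * (r * t) * b * q -> commute q r ->
  commute r t -> commute (t * r) b.
  rewrite -mulgA => + qr; rewrite qr mulgA => /mulIg E rt.
  rewrite rt in E; move: (congr1 (fun x => b * x) E).
  by rewrite /commute; free_group.
have -> : a ⋆ lam b c = (a ⋆ (b ⋆ c)) * (a ⋆ c).
  rewrite lamE starMr -(mulgA (a ⋆ (b ⋆ c))).
  by rewrite (star_commute b c a c) (mulgA (a ⋆ (b ⋆ c))) mulgK.
apply: (comm_tr _ (b ⋆ c)); [|exact: star_commute|exact: star_commute].
rewrite -star_circ circE starMl (starMl a).
by rewrite -(commuteV (star_commute a c a b)) mulgVK AA.
Qed.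

End TwoSidedAssociative.

End SkewBrace.

Theorem theorem3p10 (A : skewBraceType) :
  (two_sided A -> star_associative A -> star_square A `<=` group_center A) /\
  (two_sided A -> star_square A `<=` group_center A -> star_associative A) /\
  (star_associative A -> star_square A `<=` group_center A -> two_sided A).
Proof.
rewrite star_square_center; split; first exact: two_sided_assoc_central.
split; [exact: two_sided_central_assoc | exact: assoc_central_two_sided].
Qed.
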